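(* Let $Trans_1, Trans_2, \ldots, Trans_{r_R}$ be the $r_R$ postfixes, in a given node of the DFA, of the tuples obtained (by following the chain of 0-labelled edges from the initial node to that node) from the $r_R$ tuples of the initial node whose postfixes are the standard basis postfixes $SBP_0=(1,0,\ldots,0), SBP_1=(0,1,0,\ldots,0), \ldots, SBP_{r_R-1}=(0,\ldots,0,1)$. If $Trans_1, \ldots, Trans_{r_R}$ are linearly independent over $\mathbb{Z}_2$, then the node is reversible; otherwise the node is irreversible.
   Context: Consider a one-dimensional linear cellular automaton over $\mathbb{Z}_2$ with $n$ cells under null boundary condition ($s_i^t=0$ for $i\notin\{1,\ldots,n\}$), with neighbor vector $(-r_L,\ldots,0,\ldots,r_R)$, $r_L>0$, $r_R>0$, and linear rule $s_i^{t+1}=(\lambda_{-r_L}s^t_{i-r_L}+\cdots+\lambda_0 s^t_i+\cdots+\lambda_{r_R}s^t_{i+r_R}) \bmod 2$ with $\lambda_j\in\{0,1\}$ and $\lambda_{-r_L}=\lambda_{r_R}=1$. The associated DFA is built as follows. A tuple is a binary vector of length $r_L+r_R$; its prefix is its first $r_L$ entries and its postfix its last $r_R$ entries. A node is a list of $2^{r_R}$ tuples. The initial node consists of the $2^{r_R}$ tuples whose prefix is all zeros and whose postfixes are all $2^{r_R}$ binary vectors of length $r_R$. The next node along a 0-labelled edge is obtained by mapping each tuple $(s_{i-r_L},\ldots,s_{i+r_R-1})$ to $(s_{i-r_L+1},\ldots,s_{i+r_R})$, where $s_{i+r_R}$ is the unique value with $\lambda_{-r_L}s_{i-r_L}+\cdots+\lambda_{r_R}s_{i+r_R}\equiv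 0 \pmod 2$; repeating this returns to the initial node after a number of steps called the period. The $k$-th node is called reversible if the LCA with $n=k+m\cdot\text{period}$ cells ($m\ge 0$) is reversible; it is known that a node is reversible if and only if the postfixes of its $2^{r_R}$ tuples are pairwise distinct. *)

(* Defs.v *)
From HB Require Import structures.
From mathcomp Require Import all_boot all_order all_algebra all_fingroup.
Set Implicit Arguments.
Unset Strict Implicit.
Unset Printing Implicit Defensive.
Import GRing.Theory.
Local Open Scope ring_scope.

(* Entry [j] of a rule is the coefficient lambda_(j - rL) of the cell at
   offset [j - rL]; [ord0] is the offset -rL and [ord_max] the offset rR. *)
Record lca_rule (rL rR : nat) := LcaRule {
  coef :> 'I_(rL + rR).+1 -> 'F_2;
  coef_first : coef ord0 = 1;
  coef_last : coef ord_max = 1 }.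

(* Cells are numbered from 0 to n - 1; the others are 0 (null boundary). *)
Definition cell (n : nat) (s : 'rV['F_2]_n) (i : int) : 'F_2 :=
  if i is Posz p then oapp (s ord0) 0 (insub p) else 0.

Section LCA.
Variables (rL rR : nat) (lam : lca_rule rL rR).

Definition lca_step (n : nat) (s : 'rV['F_2]_n) : 'rV['F_2]_n :=
  \row_(i < n) \sum_(j < (rL + rR).+1)
    lam j * cell s ((i : nat)%:Z + (j : nat)%:Z - rL%:Z).

Definition lca_reversible (n : nat) : Prop := bijective (@lca_step n).

(* The prefix of a DFA tuple is [lsubmx], its postfix is [rsubmx]. *)
Definition dfa_tuple := 'rV['F_2]_(rL + rR).

Definition extend (u : dfa_tuple) (x : 'F_2) : 'rV['F_2]_(rL + rR).+1 :=
  \row_j (if unlift ord_max j is Some j' then u ord0 j' else x).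

(* Congruence that the entry [x] following the tuple [u] must satisfy along a
   0-labelled edge. *)
Definition zero_edge (u : dfa_tuple) (x : 'F_2) : bool :=
  \sum_j lam j * extend u x ord0 j == 0.

Lemma zero_edgeE u x :
  zero_edge u x = (x == - \sum_j lam (lift ord_max j) * u ord0 j).
Proof.
rewrite /zero_edge (bigD1_ord ord_max) //= mxE unlift_none coef_last mul1r.
rewrite -addr_eq0; congr (x + _ == 0).
by apply: eq_bigr => j _; rewrite mxE liftK.
Qed.

Lemma zero_edge_ex u : exists x, zero_edge u x.
Proof. by eexists; rewrite zero_edgeE. Qed.

Lemma zero_edge_uniq u x y : zero_edge u x -> zero_edge u y -> x = y.
Proof. by rewrite !zero_edgeE => /eqP-> /eqP->. Qed.

Definition next_cell (u : dfa_tuple) : 'F_2 := xchoose (zero_edge_ex u).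

Definition next_tuple (u : dfa_tuple) : dfa_tuple :=
  \row_j extend u (next_cell u) ord0 (lift ord0 j).

Definition dfa_node := seq dfa_tuple.

Definition init_tuple (p : 'rV['F_2]_rR) : dfa_tuple := row_mx 0 p.

Definition init_node : dfa_node := [seq init_tuple p | p <- enum 'rV['F_2]_rR].

Definition next_node (N : dfa_node) : dfa_node := map next_tuple N.

Definition node (k : nat) : dfa_node := iter k next_node init_node.

Lemma size_node k : size (node k) = (2 ^ rR)%N.
Proof.
elim: k => [|k IHk]; last by rewrite /= size_map.
by rewrite size_map -cardE card_mx card_Fp // mul1n.
Qed.

Lemma next_tuple_inj : injective next_tuple.
Proof.
move=> u v uv.
have ext j : extend u (next_cell u) ord0 (lift ord0 j)
           = extend v (next_cell v) ord0 (lift ord0 j).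
  by have /rowP/(_ j) := uv; rewrite !mxE.
have ext0 : extend u (next_cell u) ord0 ord0 = extend v (next_cell v) ord0 ord0.
  have := xchooseP (zero_edge_ex u); have := xchooseP (zero_edge_ex v).
  rewrite /zero_edge !big_ord_recl coef_first !mul1r => /eqP.
  move=> /(canRL (addrK _)) -> /eqP/(canRL (addrK _)) ->.
  by congr (_ - _); apply: eq_bigr => j _; rewrite ext.
apply/rowP => j; have {ext0} exta i :
    extend u (next_cell u) ord0 i = extend v (next_cell v) ord0 i.
  by case: (unliftP ord0 i) => [i'|] ->.
by have := exta (lift ord_max j); rewrite !mxE liftK.
Qed.

Lemma node_returns : exists p, (0 < p)%N && (node p == node 0).
Proof.
pose f := perm next_tuple_inj; exists #[f]%g; rewrite order_gt0 andTb.
have nodeE m : node m = [seq (f ^+ m)%g u | u <- init_node].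
  elim: m => [|m IHm].
    by rewrite expg0 (eq_map (g := id)) ?map_id // => u; rewrite perm1.
  rewrite /node iterS -/(node m) IHm /next_node -map_comp.
  by apply/eq_in_map => u _ /=; rewrite expgSr permM permE.
by rewrite !nodeE expg_order expg0.
Qed.

Definition period : nat := ex_minn node_returns.

(* Node [k] stands for the automata with [k + m * period] cells, for all [m];
   irreversibility is asserted of each of them, which implies the negation of
   [node_reversible]. *)
Definition node_reversible (k : nat) : Prop :=
  forall m, lca_reversible (k + m * period)%N.

Definition node_irreversible (k : nat) : Prop :=
  forall m, ~ lca_reversible (k + m * period)%N.

Definition SBP (j : 'I_rR) : 'rV['F_2]_rR := delta_mx ord0 j.

Definition Trans (k : nat) (j : 'I_rR) : 'rV['F_2]_rR :=
  rsubmx (iter k next_tuple (init_tuple (SBP j))).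

End LCA.

(* Main.v *)
Require Import Defs.
From mathcomp Require Import all_boot all_order all_algebra.
From HB Require Import structures.
From mathcomp Require Import zify.

(* Follow a tuple [init_tuple p] for [n] steps: its successive entries are the
   cells [-rL, ..., n + rR - 1] of the only configuration that starts with [rL]
   zeros and [p] and is sent to 0 at the cells [0, ..., n - 1].  The null
   boundary condition on the right says that the final postfix is 0, so the
   kernel of the automaton on [n] cells is isomorphic to the kernel of the linear
   map [postfix n], of which the vectors [Trans n j] are the images of the
   standard basis. *)

Set Implicit Arguments.
Unset Strict Implicit.
Unset Printing Implicit Defensive.
Import GRing.Theory.
Local Open Scope ring_scope.

Lemma cell_lt n (s : 'rV['F_2]_n) (i : 'I_n) : cell s (i : nat)%:Z = s ord0 i.
Proof. by rewrite /cell valK. Qed.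

Lemma cell_ge n (s : 'rV['F_2]_n) m : (n <= m)%N -> cell s m%:Z = 0.
Proof. by move=> le_nm; rewrite /cell insubF // ltnNge le_nm. Qed.

Lemma cell_lt0 n (s : 'rV['F_2]_n) (z : int) : z < 0 -> cell s z = 0.
Proof. by case: z. Qed.

Lemma cell_linear n a (s t : 'rV['F_2]_n) z :
  cell (a *: s + t) z = a * cell s z + cell t z.
Proof.
case: z => [m|m] /=; last by rewrite mulr0 addr0.
by case: insubP => [i _ _|_] /=; rewrite ?mxE // mulr0 addr0.
Qed.

Lemma cell0 n z : cell (0 : 'rV['F_2]_n) z = 0.
Proof. by case: z => [m|m] //=; case: insubP => [i _ _|_] //=; rewrite mxE. Qed.

Section Automaton.
Variables (rL rR : nat) (lam : lca_rule rL rR).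

Local Notation next := (next_tuple lam).

Lemma lca_step_linear n : linear (@lca_step rL rR lam n).
Proof.
move=> a s t; apply/rowP=> i; rewrite !mxE mulr_sumr -big_split /=.
by apply: eq_bigr => j _; rewrite cell_linear mulrDr mulrCA.
Qed.

HB.instance Definition _ n :=
  GRing.isLinear.Build 'F_2 _ _ *:%R (@lca_step rL rR lam n) (@lca_step_linear n).

(** An additive map with trivial kernel is injective, and an injective self-map of a finite set is
    bijective. *)
Lemma lca_reversible_ker n :
  lca_reversible lam n <-> (forall s, @lca_step rL rR lam n s = 0 -> s = 0).
Proof.
split=> [/bij_inj f_inj s s0 | /raddf_inj/injF_bij //].
by apply: f_inj; rewrite s0 linear0.
Qed.

Lemma next_cellE u : next_cell lam u = - \sum_j lam (lift ord_max j) * u ord0 j.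
Proof. by apply/eqP; rewrite -zero_edgeE; apply: xchooseP. Qed.

Lemma next_tuple_linear : linear next.
Proof.
move=> a u v; apply/rowP=> j; rewrite !mxE.
case: unliftP => [j' _|_]; first by rewrite !mxE.
rewrite !next_cellE mulrN -opprD mulr_sumr -big_split /=; congr (- _).
by apply: eq_bigr => i _; rewrite !mxE mulrDr mulrCA.
Qed.

HB.instance Definition _ :=
  GRing.isLinear.Build 'F_2 _ _ *:%R next next_tuple_linear.

(** Here and below a tuple is read as the first [rL + rR] terms of a sequence [f] on [nat], so that
    sliding the window just adds 1 to the index. *)
Lemma extendE (u : dfa_tuple rL rR) (f : nat -> 'F_2) j :
  (forall i : 'I_(rL + rR), u ord0 i = f i) ->
  extend u (f (rL + rR)%N) ord0 j = f j.
Proof.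
by move=> uf; rewrite mxE; case: unliftP => [j'|] -> //; rewrite uf lift_max.
Qed.

Lemma zero_edge_window (u : dfa_tuple rL rR) (f : nat -> 'F_2) :
  (forall i : 'I_(rL + rR), u ord0 i = f i) ->
  zero_edge lam u (f (rL + rR)%N) = (\sum_(j < (rL + rR).+1) lam j * f j == 0).
Proof.
by move=> uf; congr (_ == 0); apply: eq_bigr => j _; rewrite extendE.
Qed.

Lemma next_cell_window (u : dfa_tuple rL rR) (f : nat -> 'F_2) :
    (forall i : 'I_(rL + rR), u ord0 i = f i) ->
    \sum_(j < (rL + rR).+1) lam j * f j = 0 ->
  forall j : 'I_(rL + rR), next u ord0 j = f j.+1.
Proof.
move=> uf /eqP; rewrite -(zero_edge_window uf) => edge j.
have nx := xchooseP (zero_edge_ex lam u).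
by rewrite mxE -[RHS]/(f (lift ord0 j)) /next_cell (zero_edge_uniq nx edge) extendE.
Qed.

(** Converse of [next_cell_window]: the last entry of [next u] was chosen to satisfy the rule. Since
    [rL] is positive, tuples are nonempty and this entry exists. *)
Lemma window_rule (u : dfa_tuple rL rR) (f : nat -> 'F_2) :
    (0 < rL)%N ->
    (forall i : 'I_(rL + rR), u ord0 i = f i) ->
    (forall i : 'I_(rL + rR), next u ord0 i = f i.+1) ->
  \sum_(j < (rL + rR).+1) lam j * f j = 0.
Proof.
move=> rL_gt0 uf nf; apply/eqP; rewrite -(zero_edge_window uf).
have lt_last : ((rL + rR).-1 < rL + rR)%N by lia.
have /= := nf (Ordinal lt_last); rewrite prednK; last by lia.
move=> <-; rewrite mxE; have -> : lift ord0 (Ordinal lt_last) = ord_max.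
  by apply: val_inj => /=; rewrite /bump /=; lia.
by rewrite mxE unlift_none; apply: xchooseP.
Qed.

Lemma next_tuple_shift (u : dfa_tuple rL rR) (i j : 'I_(rL + rR)) :
  j = i.+1 :> nat -> next u ord0 i = u ord0 j.
Proof.
move=> ji; rewrite mxE; have -> : lift ord0 i = lift ord_max j.
  by apply: ord_inj; rewrite lift_max ji.
by rewrite mxE liftK.
Qed.

(** Successive tuples are windows sliding by one position per step, so an entry depends only on its
    absolute position. *)
Lemma iter_next_window (u : dfa_tuple rL rR) m m' (j j' : 'I_(rL + rR)) :
    (m + j = m' + j')%N ->
  iter m next u ord0 j = iter m' next u ord0 j'.
Proof.
wlog le_mm' : m m' j j' / (m <= m')%N => [IH|].
  by case: (leqP m m') => [|/ltnW] le_m e; [|apply/esym]; apply: IH.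
rewrite -(subnK le_mm').
elim: (m' - m)%N j' => [|d IH] j' e.
  by rewrite add0n; congr (_ ord0 _); apply: ord_inj; lia.
have lt_j : (j'.+1 < rL + rR)%N by move: (ltn_ord j); lia.
rewrite addSn iterS (@next_tuple_shift _ _ (Ordinal lt_j)) //; apply: IH => /=; lia.
Qed.

Definition postfix n (p : 'rV['F_2]_rR) : 'rV['F_2]_rR :=
  rsubmx (iter n next (init_tuple rL p)).

Lemma postfix_linear n : linear (postfix n).
Proof.
move=> a p q; rewrite /postfix -linearP; congr rsubmx.
elim: n => [|n IH]; last by rewrite /= IH linearP.
by rewrite /= /init_tuple scale_row_mx add_row_mx scaler0 addr0.
Qed.

HB.instance Definition _ n :=
  GRing.isLinear.Build 'F_2 _ _ *:%R (postfix n) (postfix_linear n).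

(** A linear combination of the [Trans] vectors is the value of [postfix n] at the row of its
    coefficients, so linear relations are kernel vectors. *)
Lemma free_Trans n :
  free [tuple Trans lam n j | j < rR] <-> (forall p, postfix n p = 0 -> p = 0).
Proof.
have combE (c : 'I_rR -> 'F_2) :
    \sum_(i < rR) c i *: [tuple Trans lam n j | j < rR]`_i
      = postfix n (\row_i c i).
  rewrite (row_sum_delta (\row_i c i)) linear_sum; apply: eq_bigr => i _.
  by rewrite linearZ mxE (nth_map i) ?nth_ord_enum // size_enum_ord.
split=> [/freeP free_T p p0 | ker0].
  apply/rowP=> i; rewrite mxE; apply: (free_T (p ord0)); rewrite combE.
  by rewrite -[RHS]p0; congr (postfix n _); apply/rowP => j; rewrite mxE.
by apply/freeP => c; rewrite combE => /ker0/rowP c0 i; have := c0 i; rewrite !mxE.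
Qed.

(** By induction on [i]: the rule at cell [i] forces the entry appended at the next step. The bound
    [i <= n] keeps the cells where the rule is applied inside the array. *)
Lemma lca_kernel_window n (s : 'rV['F_2]_n) i (j : 'I_(rL + rR)) :
    @lca_step rL rR lam n s = 0 -> (i <= n)%N ->
  iter i next (init_tuple rL (\row_(l < rR) cell s (l : nat)%:Z)) ord0 j
    = cell s ((i + j)%N%:Z - rL%:Z).
Proof.
move=> s0; elim: i j => [|i IH] j le_in.
  case: (split_ordP j) => l ->.
    by rewrite row_mxEl mxE cell_lt0 //=; move: (ltn_ord l); lia.
  by rewrite row_mxEr mxE; congr cell => /=; lia.
pose f m := cell s ((i + m)%N%:Z - rL%:Z).
rewrite iterS addSnnS.
apply: (next_cell_window (f := f)) => [l|]; first by rewrite IH // ltnW.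
have /rowP/(_ (Ordinal le_in)) := s0; rewrite !mxE; exact.
Qed.

Lemma lca_reversible_postfix n : (0 < rL)%N -> (0 < rR)%N ->
  lca_reversible lam n <-> (forall p, postfix n p = 0 -> p = 0).
Proof.
move=> rL_gt0 rR_gt0; rewrite lca_reversible_ker; split=> [ker0 p p0 | ker0 s s0].
  (* Entry [rL] of the tuple at step [m] lies over cell [m], so [f] reads off the configuration. *)
  pose first_cell := rshift rL (Ordinal rR_gt0).
  pose f m := iter m next (init_tuple rL p) ord0 first_cell.
  pose s : 'rV['F_2]_n := \row_i f i.
  have windowE i (j : 'I_(rL + rR)) : (i <= n)%N ->
      iter i next (init_tuple rL p) ord0 j = cell s ((i + j)%N%:Z - rL%:Z).
    (* Three zones: left of cell 0 the entry comes from the zero initial prefix, inside the array it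
       is [s] by definition, and from cell [n] on it belongs to the final postfix, null by [p0]. *)
    move=> le_in; case: (ltnP (i + j) rL) => [lt_ijL | le_Lij].
      rewrite cell_lt0; last by lia.
      have lt_ij : (i + j < rL + rR)%N by lia.
      rewrite (@iter_next_window _ i 0 j (Ordinal lt_ij)) //=.
      have -> : Ordinal lt_ij = lshift rR (Ordinal lt_ijL) by apply: val_inj.
      by rewrite row_mxEl mxE.
    rewrite subzn //; case: (ltnP (i + j - rL) n) => [lt_n | le_n].
      rewrite (cell_lt s (Ordinal lt_n)) mxE; apply: iter_next_window => /=; lia.
    rewrite cell_ge //; have lt_l : (i + j - rL - n < rR)%N by move: (ltn_ord j); lia.
    have /rowP/(_ (Ordinal lt_l)) := p0; rewrite !mxE => <-.
    apply: iter_next_window => /=; lia.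
  have s0 : s = 0.
    apply: ker0; apply/rowP => i; rewrite mxE [RHS]mxE.
    pose g m := cell s ((i + m)%N%:Z - rL%:Z).
    apply: (@window_rule (iter i next (init_tuple rL p)) g) => // j.
      by rewrite windowE // ltnW.
    by rewrite -[next _]/(iter i.+1 next _) windowE // addSnnS.
  apply/rowP => l; have := windowE 0 (rshift rL l) (leq0n n).
  by rewrite /= row_mxEr => ->; rewrite s0 cell0 mxE.
pose p : 'rV['F_2]_rR := \row_l cell s (l : nat)%:Z.
(* The final postfix lies over the cells [n] to [n + rR - 1], which are null by the boundary
   condition. *)
have p0 : p = 0.
  apply: ker0; apply/rowP => l; rewrite !mxE lca_kernel_window //=.
  have -> : (n + (rL + l))%N%:Z - rL%:Z = (n + l)%N%:Z by lia.
  by rewrite cell_ge // leq_addr.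
have init0 i : iter i next (init_tuple rL p) = 0.
  elim: i => [|i IH]; first by rewrite p0 /= /init_tuple row_mx0.
  by rewrite iterS IH linear0.
apply/rowP => i; rewrite mxE -cell_lt.
have := lca_kernel_window (rshift rL (Ordinal rR_gt0)) s0 (ltnW (ltn_ord i)).
rewrite -/p init0 mxE => ->; congr cell => /=; lia.
Qed.

Lemma node_map n :
  node lam n = [seq iter n next (init_tuple rL p) | p <- enum 'rV['F_2]_rR].
Proof. by elim: n => //= n ->; rewrite /next_node -map_comp. Qed.

Lemma iter_next_period n m p :
  iter (n + m * period lam) next (init_tuple rL p) = iter n next (init_tuple rL p).
Proof.
rewrite iterD; congr iter; elim: m => // m IH.
rewrite mulSn addnC iterD.
have -> : iter (period lam) next (init_tuple rL p) = init_tuple rL p.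
  rewrite /period; case: ex_minnP => per /andP[_ /eqP per0] _.
  (* Both nodes list their tuples along the same enumeration, so equality of the lists means that
     every single tuple returns. *)
  by move: per0; rewrite !node_map => /eq_in_map; apply; rewrite mem_enum.
exact: IH.
Qed.

Lemma Trans_period n m j : Trans lam (n + m * period lam)%N j = Trans lam n j.
Proof. by rewrite /Trans iter_next_period. Qed.

(** The vectors [Trans] recur after each period, so one freeness test settles all the automata
    attached to a node. *)
Lemma lca_reversible_Trans n m : (0 < rL)%N -> (0 < rR)%N ->
  lca_reversible lam (n + m * period lam)%N <->
  free [tuple Trans lam n j | j < rR].
Proof.
move=> rL_gt0 rR_gt0; rewrite lca_reversible_postfix // -free_Trans.
by rewrite (_ : mktuple _ = mktuple (Trans lam n)) //; apply/eq_mktuple/Trans_period.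
Qed.

End Automaton.

Theorem theorem7 (rL rR : nat) (rL_gt0 : (0 < rL)%N) (rR_gt0 : (0 < rR)%N)
    (lam : lca_rule rL rR) (k : nat) :
  (free [tuple Trans lam k j | j < rR] -> node_reversible lam k) /\
  (~~ free [tuple Trans lam k j | j < rR] -> node_irreversible lam k).
Proof.
split=> [free_T m | /negP nfree_T m]; first exact/lca_reversible_Trans.
by move/lca_reversible_Trans => /(_ rL_gt0 rR_gt0).
Qed.
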